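(* Let $\mathbb{H}_1$ and $\mathbb{H}_2$ be localic $\mathcal{S}$-fibered categories endowed with localic internal tensor structures $(\otimes_1,m_1)$ and $(\otimes_2,m_2)$, respectively, let $R: \mathbb{H}_1\to\mathbb{H}_2$ be a localic morphism of $\mathcal{S}$-fibered categories, let $\rho$ be a triangulated internal tensor structure on the underlying morphism of $\mathcal{U}$-fibered categories, and let $\tilde{\rho}$ be the unique triangulated internal tensor structure on the morphism of $\mathcal{S}$-fibered categories $R$ restricting to $\rho$ over $\mathcal{U}$. Then the following statements hold: (1) Let $a_1$ and $a_2$ be internal associativity constraints on the restrictions to $\mathcal{U}$ of $(\otimes_1,m_1)$ and $(\otimes_2,m_2)$, respectively, and suppose that $\rho$ is associative with respect to $a_1$ and $a_2$. Then $\tilde{\rho}$ is associative with respect to the extended constraints $\tilde{a}_1$ and $\tilde{a}_2$ over $\mathcal{S}$. (2) Let $c_1$ and $c_2$ be internal commutativity constraints on the restrictions to $\mathcal{U}$ of $(\otimes_1,m_1)$ and $(\otimes_2,m_2)$, respectively, and suppose that $\rho$ is symmetric with respect to $c_1$ and $c_2$. Then $\tilde{\rho}$ is symmetric with respect to the extended constraints $\tilde{c}_1$ and $\tilde{c}_2$ over $\mathcal{S}$. (3) Let $u_1$ and $u_2$ be internal unit constraints on the restrictions to $\mathcal{U}$ of $(\otimes_1,m_1)$ and $(\otimes_2,m_2)$ with unit sections $\mathbf{1}^{(1)}$ and $\mathbf{1}^{(2)}$, respectively, and suppose that $\rho$ is unitary via an isomorphism of sections $w: R(\mathbf{1}^{(1)})\xrightarrow{\sim}\mathbf{1}^{(2)}$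 over $\mathcal{U}$ with respect to $u_1$ and $u_2$. Then $\tilde{\rho}$ is unitary via the extended isomorphism $\tilde{w}: R(\tilde{\mathbf{1}}^{(1)})\xrightarrow{\sim}\tilde{\mathbf{1}}^{(2)}$ over $\mathcal{S}$ with respect to the extended constraints $\tilde{u}_1$ and $\tilde{u}_2$.
   Context: Base category. $\mathcal{S}$ is a fixed small category with finite products and final object $\ast$, equipped with two (possibly non-full) subcategories $\mathcal{S}^{sm}$ (its morphisms are called smooth morphisms) and $\mathcal{S}^{cl}$ (its morphisms are called closed immersions) such that: (i) both have the same objects as $\mathcal{S}$ and contain all isomorphisms of $\mathcal{S}$; (ii) for every smooth $p: P \to S$ and every $f: T \to S$ in $\mathcal{S}$ the fibered product $P\times_S T$ exists in $\mathcal{S}$ and its projection to $T$ is smooth; (iii) for every smooth $p: P\to S$ and closed immersion $z: Z\to S$ the projection $P\times_S Z\to P$ is a closed immersion, and whenever $z: Z\to S$, $g: S\to V$ are morphisms of $\mathcal{S}$ with $gz$ a closed immersion, $z$ is a closed immersion; (iv) every $f: T\to S$ in $\mathcal{S}$ factors as $f=p\circ t$ with $t: T\to P$ a closed immersion and $p: P\to S$ smooth. $\mathcal{U}$ is the full subcategory of $\mathcal{S}$ of all $Y$ such that $Y\to\ast$ is smooth; its smooth morphisms and closed immersions are those of $\mathcal{S}$ lying in $\mathcal{U}$. Moreover: (v) $\mathcal{S}$ has an initial object $\emptyset$; (vi) for every closed immersion $z: Z\to S$ there is a distinguished smooth morphism $u: U\to S$ (the open immersion complementary to $z$; $U$ is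 the open complement of $Z$ in $S$) such that for every $T\in\mathcal{S}$ composition with $u$ identifies $\mathrm{Hom}_{\mathcal{S}}(T,U)$ with the subset of those $f\in\mathrm{Hom}_{\mathcal{S}}(T,S)$ for which the square with sides $\emptyset\to T$, $f:T\to S$, $\emptyset\to Z$, $z: Z\to S$ is Cartesian; (vii) for every $S\in\mathcal{S}$ there is a finite sequence of closed immersions $\emptyset=Z_{-1}\to Z_0\to\cdots\to Z_n=S$ such that for each $r=0,\dots,n$ the open complement of $Z_{r-1}$ in $Z_r$ belongs to $\mathcal{U}$. Fibered categories. Let $\mathcal{C}$ be $\mathcal{S}$ or $\mathcal{U}$. A $\mathcal{C}$-fibered category $\mathbb{H}$ consists of a category $\mathbb{H}(S)$ for each $S\in\mathcal{C}$, a functor $f^*:\mathbb{H}(S)\to\mathbb{H}(T)$ for each $f: T\to S$ in $\mathcal{C}$, and natural isomorphisms $\mathsf{conn}_{f,g}:(gf)^*\xrightarrow{\sim} f^*g^*$ for composable $f: T\to S$, $g: S\to V$, such that $\mathrm{id}_S^*=\mathrm{id}_{\mathbb{H}(S)}$ and, for composable $f,g,h$, the two resulting isomorphisms $(hgf)^*\xrightarrow{\sim} f^*g^*h^*$ agree. Connection isomorphisms are written as equalities. An $\mathcal{S}$-fibered category restricts to a $\mathcal{U}$-fibered category, denoted by the same symbol; likewise for all structures below. Localic fibered categories. A triangulated $\mathcal{C}$-fibered category is one where all $\mathbb{H}(S)$ are triangulated categories, all $f^*$ are triangulated functors and all connection isomorphisms are isomorphisms of triangulated functors. It is localic if: (a)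 $\mathbb{H}(\emptyset)=0$; (b) for every smooth $p: P\to S$ the functor $p^*$ has a left adjoint $p_\#$, and for every Cartesian square with $p: P\to S$ smooth, $f: T\to S$, $p': P_T\to T$, $f': P_T\to P$, the composite $p'_\#f'^*\xrightarrow{\eta}p'_\#f'^*p^*p_\#=p'_\#p'^*f^*p_\#\xrightarrow{\epsilon}f^*p_\#$ is invertible; (c) for every closed immersion $z: Z\to S$ the functor $z^*$ has a right adjoint $z_*$, which is fully faithful; (d) for every closed immersion $z$ with complementary open immersion $u$, the pair $(z^*,u^* )$ is conservative. Here $\eta$ and $\epsilon$ denote units and co-units of adjunctions. Morphisms. A morphism of $\mathcal{C}$-fibered categories $R:\mathbb{H}_1\to\mathbb{H}_2$ consists of functors $R_S:\mathbb{H}_1(S)\to\mathbb{H}_2(S)$ for $S\in\mathcal{C}$ and natural isomorphisms $\theta_f: f^*R_S(A)\xrightarrow{\sim}R_T(f^*A)$ for $f: T\to S$ in $\mathcal{C}$ such that, for composable $f: T\to S$, $g: S\to V$, the isomorphism $\theta_{gf}$ equals the composite $f^*g^*R_V(A)\xrightarrow{\theta_g}f^*R_S(g^*A)\xrightarrow{\theta_f}R_T(f^*g^*A)$ (modulo connection isomorphisms). It is triangulated if the $R_S$ are triangulated functors and the $\theta_f$ are isomorphisms of triangulated functors. A triangulated morphism between localic ones is localic if for every smooth $p: P\to S$ in $\mathcal{C}$ the composite $p_\#R_P(A)\xrightarrow{\eta}p_\#R_P(p^*p_\#A)\xrightarrow{\theta_p^{-1}}p_\#p^*R_S(p_\#A)\xrightarrow{\epsilon}R_S(p_\#A)$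 is invertible. Tensor structures. An internal tensor structure $(\otimes,m)$ on a $\mathcal{C}$-fibered category $\mathbb{H}$ consists of functors $-\otimes-:\mathbb{H}(S)\times\mathbb{H}(S)\to\mathbb{H}(S)$ for $S\in\mathcal{C}$ and natural isomorphisms $m_f: f^*A\otimes f^*B\xrightarrow{\sim}f^*(A\otimes B)$ for $f: T\to S$ in $\mathcal{C}$ such that for composable $f,g$ the isomorphism $m_{gf}$ equals the composite $f^*g^*A\otimes f^*g^*B\xrightarrow{m_f}f^*(g^*A\otimes g^*B)\xrightarrow{m_g}f^*g^*(A\otimes B)$ (modulo connection isomorphisms). It is triangulated if the functors $\otimes$ are bi-triangulated and the $m_f$ are isomorphisms of bi-triangulated functors. A triangulated internal tensor structure is localic if for every smooth $p: P\to S$ in $\mathcal{C}$ the composites $p_\#(A\otimes p^*B)\xrightarrow{\eta}p_\#(p^*p_\#A\otimes p^*B)\xrightarrow{m}p_\#p^*(p_\#A\otimes B)\xrightarrow{\epsilon}p_\#A\otimes B$ and $p_\#(p^*A\otimes B)\xrightarrow{\eta}p_\#(p^*A\otimes p^*p_\#B)\xrightarrow{m}p_\#p^*(A\otimes p_\#B)\xrightarrow{\epsilon}A\otimes p_\#B$ are invertible. Tensor structures on morphisms. Given internal tensor structures $(\otimes_i,m_i)$ on $\mathbb{H}_i$ over $\mathcal{C}$ ($i=1,2$), an internal tensor structure $\rho$ on a morphism $R:\mathbb{H}_1\to\mathbb{H}_2$ is a family of natural isomorphisms $\rho_S: R_S(A)\otimes_2R_S(B)\xrightarrow{\sim}R_S(A\otimes_1B)$,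 $S\in\mathcal{C}$, such that for every $f: T\to S$ in $\mathcal{C}$ the composites $f^*R_S(A)\otimes_2f^*R_S(B)\xrightarrow{m_2}f^*(R_S(A)\otimes_2R_S(B))\xrightarrow{\rho}f^*R_S(A\otimes_1B)\xrightarrow{\theta}R_T(f^*(A\otimes_1B))$ and $f^*R_S(A)\otimes_2f^*R_S(B)\xrightarrow{\theta}R_T(f^*A)\otimes_2R_T(f^*B)\xrightarrow{\rho}R_T(f^*A\otimes_1f^*B)\xrightarrow{m_1}R_T(f^*(A\otimes_1B))$ coincide. It is triangulated if each $\rho_S$ is an isomorphism of bi-triangulated functors. In the situation of the claim, every such triangulated $\rho$ over $\mathcal{U}$ extends uniquely to a triangulated internal tensor structure on $R$ over $\mathcal{S}$. Constraints. Let $(\otimes,m)$ be an internal tensor structure over $\mathcal{C}$. - An internal associativity constraint $a$ is a family of natural isomorphisms $a_S:(A\otimes B)\otimes C\xrightarrow{\sim}A\otimes(B\otimes C)$, $S\in\mathcal{C}$, satisfying the usual pentagon axiom for every $S$ and, for every $f: T\to S$ in $\mathcal{C}$, such that $(f^*A\otimes f^*B)\otimes f^*C\xrightarrow{m}f^*(A\otimes B)\otimes f^*C\xrightarrow{m}f^*((A\otimes B)\otimes C)\xrightarrow{a}f^*(A\otimes(B\otimes C))$ equals $(f^*A\otimes f^*B)\otimes f^*C\xrightarrow{a}f^*A\otimes(f^*B\otimes f^*C)\xrightarrow{m}f^*A\otimes f^*(B\otimes C)\xrightarrow{m}f^*(A\otimes(B\otimes C))$. - An internal commutativity constraint $c$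 is a family of natural isomorphisms $c_S: A\otimes B\xrightarrow{\sim}B\otimes A$, $S\in\mathcal{C}$, with $c\circ c=\mathrm{id}$ and $m_f\circ c_T=f^*(c_S)\circ m_f$ for every $f: T\to S$. - A section $A$ of $\mathbb{H}$ over $\mathcal{C}$ consists of objects $A_S\in\mathbb{H}(S)$ and isomorphisms $A_f^*: f^*A_S\xrightarrow{\sim}A_T$ for $f: T\to S$ with $A_{gf}^*=A_f^*\circ f^*(A_g^* )$ for composable $f: V\to T$, $g: T\to S$; a morphism of sections $w: A\to B$ is a family $w_S: A_S\to B_S$ with $B_f^*\circ f^*(w_S)=w_T\circ A_f^*$. Every section over $\mathcal{U}$ extends, uniquely up to unique isomorphism restricting to the identity over $\mathcal{U}$, to a section over $\mathcal{S}$, compatibly with morphisms of sections. The image $R(A)$ of a section $A$ of $\mathbb{H}_1$ is the section of $\mathbb{H}_2$ with $R(A)_S=R_S(A_S)$ and $R(A)_f^*: f^*R_S(A_S)\xrightarrow{\theta_f}R_T(f^*A_S)\xrightarrow{R_T(A_f^* )}R_T(A_T)$. - An internal unit constraint $u$ consists of a section $\mathbf{1}$ over $\mathcal{C}$ (the unit section) and natural isomorphisms $u_{r,S}: A\otimes\mathbf{1}_S\xrightarrow{\sim}A$, $u_{l,S}:\mathbf{1}_S\otimes B\xrightarrow{\sim}B$, $S\in\mathcal{C}$, such that $u_{r,S}=u_{l,S}$ on $\mathbf{1}_S\otimes\mathbf{1}_S$ and, for every $f: T\to S$, $u_{r,T}\circ(\mathrm{id}\otimes\mathbf{1}_f^*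 )=f^*(u_{r,S})\circ m_f$ on $f^*A\otimes f^*\mathbf{1}_S$ and $u_{l,T}\circ(\mathbf{1}_f^*\otimes\mathrm{id})=f^*(u_{l,S})\circ m_f$ on $f^*\mathbf{1}_S\otimes f^*B$. Constraints over $\mathcal{U}$ on the restriction of a localic $(\otimes_i,m_i)$ extend uniquely to constraints $\tilde a_i,\tilde c_i,\tilde u_i$ of the same kind on $(\otimes_i,m_i)$ over $\mathcal{S}$ (with $\tilde u_i$ having unit section $\tilde{\mathbf{1}}^{(i)}$, the section over $\mathcal{S}$ extending $\mathbf{1}^{(i)}$). The extended isomorphism $\tilde w$ is the unique isomorphism of sections of $\mathbb{H}_2$ over $\mathcal{S}$ from $R(\tilde{\mathbf{1}}^{(1)})$ to $\tilde{\mathbf{1}}^{(2)}$ restricting to $w$ over $\mathcal{U}$. Properties of $\rho$ (over $\mathcal{C}$; required for every $S\in\mathcal{C}$). - $\rho$ is associative with respect to $a_1,a_2$ if $(R_S(A)\otimes_2R_S(B))\otimes_2R_S(C)\xrightarrow{\rho}R_S(A\otimes_1B)\otimes_2R_S(C)\xrightarrow{\rho}R_S((A\otimes_1B)\otimes_1C)\xrightarrow{a_1}R_S(A\otimes_1(B\otimes_1C))$ equals $(R_S(A)\otimes_2R_S(B))\otimes_2R_S(C)\xrightarrow{a_2}R_S(A)\otimes_2(R_S(B)\otimes_2R_S(C))\xrightarrow{\rho}R_S(A)\otimes_2R_S(B\otimes_1C)\xrightarrow{\rho}R_S(A\otimes_1(B\otimes_1C))$. - $\rho$ is symmetric with respect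 to $c_1,c_2$ if $R_S(c_1)\circ\rho=\rho\circ c_2$ as maps $R_S(A)\otimes_2R_S(B)\to R_S(B\otimes_1A)$. - $\rho$ is unitary via an isomorphism of sections $w: R(\mathbf{1}^{(1)})\xrightarrow{\sim}\mathbf{1}^{(2)}$ with respect to $u_1,u_2$ if $R_S(A)\otimes_2R_S(\mathbf{1}^{(1)}_S)\xrightarrow{\rho}R_S(A\otimes_1\mathbf{1}^{(1)}_S)\xrightarrow{u_{1,r}}R_S(A)$ equals $R_S(A)\otimes_2R_S(\mathbf{1}^{(1)}_S)\xrightarrow{w_S}R_S(A)\otimes_2\mathbf{1}^{(2)}_S\xrightarrow{u_{2,r}}R_S(A)$, and symmetrically $R_S(\mathbf{1}^{(1)}_S)\otimes_2R_S(B)\xrightarrow{\rho}R_S(\mathbf{1}^{(1)}_S\otimes_1B)\xrightarrow{u_{1,l}}R_S(B)$ equals $R_S(\mathbf{1}^{(1)}_S)\otimes_2R_S(B)\xrightarrow{w_S}\mathbf{1}^{(2)}_S\otimes_2R_S(B)\xrightarrow{u_{2,l}}R_S(B)$. *)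

(* Defs.v *)
(* Only the Rocq prelude is used. Morphisms are compared by Leibniz equality;
   smallness of the base category is left to universe levels. *)

Set Implicit Arguments.
Unset Strict Implicit.
Unset Printing Implicit Defensive.

Record Category : Type := {
  Ob :> Type;
  Hom : Ob -> Ob -> Type;
  idm : forall A, Hom A A;
  comp : forall A B C, Hom B C -> Hom A B -> Hom A C;
  comp_id_l : forall A B (f : Hom A B), comp (idm B) f = f;
  comp_id_r : forall A B (f : Hom A B), comp f (idm A) = f;
  comp_assoc : forall A B C D (f : Hom A B) (g : Hom B C) (h : Hom C D),
    comp h (comp g f) = comp (comp h g) f
}.

Arguments Hom {_} _ _.
Arguments idm {_} _.
Arguments comp {_ _ _ _} _ _.
Arguments comp_id_l {_ _ _} _.
Arguments comp_id_r {_ _ _} _.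
Arguments comp_assoc {_ _ _ _ _} _ _ _.

Notation "A ~> B" := (Hom A B) (at level 70, no associativity).
Notation "g ∘ f" := (comp g f) (at level 40, left associativity).

Record Iso (C : Category) (A B : C) : Type := {
  fwd : A ~> B;
  bwd : B ~> A;
  bwd_fwd : bwd ∘ fwd = idm A;
  fwd_bwd : fwd ∘ bwd = idm B
}.

Arguments fwd {_ _ _} _.
Arguments bwd {_ _ _} _.

Coercion fwd : Iso >-> Hom.

Definition is_iso (C : Category) (A B : C) (f : A ~> B) : Prop :=
  exists g : B ~> A, g ∘ f = idm A /\ f ∘ g = idm B.

Definition eq_hom (C : Category) (A B : C) (e : A = B) : A ~> B :=
  match e in _ = B' return A ~> B' with eq_refl => idm A end.

Definition iso_comp (C : Category) (A B D : C) (g : Iso B D) (f : Iso A B) :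
  Iso A D.
Proof.
refine {| fwd := g ∘ f; bwd := bwd f ∘ bwd g |}.
- rewrite comp_assoc, <- (comp_assoc (fwd g) (bwd g) (bwd f)), bwd_fwd,
    comp_id_r; apply bwd_fwd.
- rewrite comp_assoc, <- (comp_assoc (bwd f) (fwd f) (fwd g)), fwd_bwd,
    comp_id_r; apply fwd_bwd.
Defined.

Record Functor (C D : Category) : Type := {
  fobj :> C -> D;
  fmap : forall A B : C, A ~> B -> fobj A ~> fobj B;
  fmap_id : forall A : C, fmap (idm A) = idm (fobj A);
  fmap_comp : forall (A B E : C) (f : A ~> B) (g : B ~> E),
    fmap (g ∘ f) = fmap g ∘ fmap f
}.

Arguments fmap {_ _} _ {_ _} _.

Definition fmap_iso (C D : Category) (F : Functor C D) (A B : C) (f : Iso A B) :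
  Iso (F A) (F B).
Proof.
refine {| fwd := fmap F f; bwd := fmap F (bwd f) |}.
- rewrite <- fmap_comp, bwd_fwd; apply fmap_id.
- rewrite <- fmap_comp, fwd_bwd; apply fmap_id.
Defined.

Definition Fid (C : Category) : Functor C C.
Proof.
refine {| fobj := fun A => A; fmap := fun A B f => f |}; reflexivity.
Defined.

Definition Fcomp (C D E : Category) (G : Functor D E) (F : Functor C D) :
  Functor C E.
Proof.
refine {| fobj := fun A => G (F A); fmap := fun A B f => fmap G (fmap F f) |}.
- intros A; rewrite !fmap_id; reflexivity.
- intros A B E' f g; rewrite !fmap_comp; reflexivity.
Defined.

Notation "G ⊚ F" := (Fcomp G F) (at level 40, left associativity).

Record NatTrans (C D : Category) (F G : Functor C D) : Type := {
  nt_app :> forall A : C, F A ~> G A;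
  nt_natural : forall (A B : C) (f : A ~> B),
    nt_app B ∘ fmap F f = fmap G f ∘ nt_app A
}.

Record NatIso (C D : Category) (F G : Functor C D) : Type := {
  ni_app :> forall A : C, Iso (F A) (G A);
  ni_natural : forall (A B : C) (f : A ~> B),
    ni_app B ∘ fmap F f = fmap G f ∘ ni_app A
}.

Record Adjunction (C D : Category) (L : Functor C D) (R : Functor D C) : Type := {
  adj_unit : NatTrans (Fid C) (R ⊚ L);
  adj_counit : NatTrans (L ⊚ R) (Fid D);
  adj_left : forall A : C,
    adj_counit (L A) ∘ fmap L (adj_unit A) = idm (L A);
  adj_right : forall B : D,
    fmap R (adj_counit B) ∘ adj_unit (R B) = idm (R B)
}.

Definition fully_faithful (C D : Category) (F : Functor C D) : Prop :=
  forall (A B : C) (g : F A ~> F B), exists! f : A ~> B, fmap F f = g.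

Definition prod_cat (C D : Category) : Category.
Proof.
refine {|
  Ob := (C * D)%type;
  Hom := fun X Y => ((fst X ~> fst Y) * (snd X ~> snd Y))%type;
  idm := fun X => (idm (fst X), idm (snd X));
  comp := fun X Y Z g f => (fst g ∘ fst f, snd g ∘ snd f)
|}.
- intros X Y [f g]; simpl; rewrite !comp_id_l; reflexivity.
- intros X Y [f g]; simpl; rewrite !comp_id_r; reflexivity.
- intros X Y Z W f g h; simpl; rewrite !comp_assoc; reflexivity.
Defined.

Notation "C ×c D" := (prod_cat C D) (at level 40, left associativity).

Definition Fprod (C C' D D' : Category) (F : Functor C D) (G : Functor C' D') :
  Functor (C ×c C') (D ×c D').
Proof.
refine {|
  fobj := fun X : C ×c C' => (F (fst X), G (snd X)) : D ×c D';
  fmap := fun (X Y : C ×c C') (f : X ~> Y) => (fmap F (fst f), fmap G (snd f))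
|}.
- intros X; simpl; rewrite !fmap_id; reflexivity.
- intros X Y Z f g; simpl; rewrite !fmap_comp; reflexivity.
Defined.

Definition Fswap (C D : Category) : Functor (C ×c D) (D ×c C).
Proof.
refine {|
  fobj := fun X : C ×c D => (snd X, fst X) : D ×c C;
  fmap := fun (X Y : C ×c D) (f : X ~> Y) => (snd f, fst f)
|}; reflexivity.
Defined.

Definition Fassoc (C D E : Category) : Functor (C ×c D ×c E) (C ×c (D ×c E)).
Proof.
refine {|
  fobj := fun X : C ×c D ×c E =>
    (fst (fst X), (snd (fst X), snd X)) : C ×c (D ×c E);
  fmap := fun (X Y : C ×c D ×c E) (f : X ~> Y) => (fst (fst f), (snd (fst f), snd f))
|}; reflexivity.
Defined.

Definition pair_r (C D : Category) (B : D) : Functor C (C ×c D).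
Proof.
refine {|
  fobj := fun A => (A, B) : C ×c D;
  fmap := fun (X Y : C) (f : X ~> Y) => (f, idm B)
|}.
- reflexivity.
- intros X Y Z f g; simpl; rewrite comp_id_l; reflexivity.
Defined.

Definition pair_l (C D : Category) (A : C) : Functor D (C ×c D).
Proof.
refine {|
  fobj := fun B => (A, B) : C ×c D;
  fmap := fun (X Y : D) (f : X ~> Y) => (idm A, f)
|}.
- reflexivity.
- intros X Y Z f g; simpl; rewrite comp_id_l; reflexivity.
Defined.

Definition bobj (C D E : Category) (F : Functor (C ×c D) E) (A : C) (B : D) : E :=
  F (A, B).

Definition bmap (C D E : Category) (F : Functor (C ×c D) E) (A A' : C) (B B' : D)
    (f : A ~> A') (g : B ~> B') : bobj F A B ~> bobj F A' B' :=
  @fmap _ _ F (A, B) (A', B') (f, g).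

Arguments bobj {_ _ _} _ _ _ /.
Arguments bmap {_ _ _} _ {_ _ _ _} _ _.

Definition full_sub (C : Category) (P : C -> Prop) : Category := {|
  Ob := {X : C | P X};
  Hom := fun X Y => proj1_sig X ~> proj1_sig Y;
  idm := fun X => idm (proj1_sig X);
  comp := fun X Y Z g f => g ∘ f;
  comp_id_l := fun X Y f => comp_id_l f;
  comp_id_r := fun X Y f => comp_id_r f;
  comp_assoc := fun X Y Z W f g h => comp_assoc f g h
|}.

Record PreAdditive (C : Category) : Type := {
  hadd : forall A B : C, A ~> B -> A ~> B -> A ~> B;
  hzero : forall A B : C, A ~> B;
  hopp : forall A B : C, A ~> B -> A ~> B;
  haddA : forall (A B : C) (f g h : A ~> B),
    hadd f (hadd g h) = hadd (hadd f g) h;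
  haddC : forall (A B : C) (f g : A ~> B), hadd f g = hadd g f;
  hadd0 : forall (A B : C) (f : A ~> B), hadd (hzero A B) f = f;
  haddN : forall (A B : C) (f : A ~> B), hadd (hopp f) f = hzero A B;
  comp_hadd_l : forall (A B D : C) (f : A ~> B) (g h : B ~> D),
    hadd g h ∘ f = hadd (g ∘ f) (h ∘ f);
  comp_hadd_r : forall (A B D : C) (f g : A ~> B) (h : B ~> D),
    h ∘ hadd f g = hadd (h ∘ f) (h ∘ g)
}.

Arguments hadd {_} _ {_ _} _ _.
Arguments hzero {_} _ _ _.
Arguments hopp {_} _ {_ _} _.

Definition zero_object (C : Category) (add : PreAdditive C) (Z : C) : Prop :=
  idm Z = hzero add Z Z.

Definition additive_functor (C D : Category) (addC : PreAdditive C)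
    (addD : PreAdditive D) (F : Functor C D) : Prop :=
  forall (A B : C) (f g : A ~> B),
    fmap F (hadd addC f g) = hadd addD (fmap F f) (fmap F g).

(* The translation functor [shift] is an auto-equivalence, not necessarily a
   strict automorphism. [dist f g h] says that X -f-> Y -g-> Z -h-> shift X is
   a distinguished triangle. *)
Record Triangulated (C : Category) : Type := {
  tri_add :> PreAdditive C;
  tri_zero : exists Z : C, zero_object tri_add Z;
  tri_biproduct : forall A B : C,
    exists (S : C) (i : A ~> S) (j : B ~> S) (p : S ~> A) (q : S ~> B),
      p ∘ i = idm A /\ q ∘ j = idm B /\
      p ∘ j = hzero tri_add B A /\ q ∘ i = hzero tri_add A B /\
      hadd tri_add (i ∘ p) (j ∘ q) = idm S;
  shift : Functor C C;
  unshift : Functor C C;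
  shift_unshift : NatIso (shift ⊚ unshift) (Fid C);
  unshift_shift : NatIso (unshift ⊚ shift) (Fid C);
  shift_additive : additive_functor tri_add tri_add shift;
  dist : forall X Y Z : C, X ~> Y -> Y ~> Z -> Z ~> shift X -> Prop;
  dist_iso : forall (X Y Z X' Y' Z' : C)
      (f : X ~> Y) (g : Y ~> Z) (h : Z ~> shift X)
      (f' : X' ~> Y') (g' : Y' ~> Z') (h' : Z' ~> shift X')
      (a : Iso X X') (b : Iso Y Y') (c : Iso Z Z'),
    b ∘ f = f' ∘ a -> c ∘ g = g' ∘ b -> fmap shift a ∘ h = h' ∘ c ->
    dist f g h -> dist f' g' h';
  dist_id : forall X Z : C, zero_object tri_add Z ->
    dist (idm X) (hzero tri_add X Z) (hzero tri_add Z (shift X));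
  dist_cone : forall (X Y : C) (f : X ~> Y),
    exists (Z : C) (g : Y ~> Z) (h : Z ~> shift X), dist f g h;
  dist_rotate : forall (X Y Z : C) (f : X ~> Y) (g : Y ~> Z) (h : Z ~> shift X),
    dist f g h <-> dist g h (hopp tri_add (fmap shift f));
  dist_complete : forall (X Y Z X' Y' Z' : C)
      (f : X ~> Y) (g : Y ~> Z) (h : Z ~> shift X)
      (f' : X' ~> Y') (g' : Y' ~> Z') (h' : Z' ~> shift X')
      (a : X ~> X') (b : Y ~> Y'),
    dist f g h -> dist f' g' h' -> b ∘ f = f' ∘ a ->
    exists c : Z ~> Z', c ∘ g = g' ∘ b /\ fmap shift a ∘ h = h' ∘ c;
  dist_octahedron : forall (X Y Z X' Y' Z' : C) (f : X ~> Y) (g : Y ~> Z)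
      (f1 : Y ~> Z') (f2 : Z' ~> shift X)
      (g1 : Z ~> X') (g2 : X' ~> shift Y)
      (h1 : Z ~> Y') (h2 : Y' ~> shift X),
    dist f f1 f2 -> dist g g1 g2 -> dist (g ∘ f) h1 h2 ->
    exists (u : Z' ~> Y') (v : Y' ~> X'),
      dist u v (fmap shift f1 ∘ g2) /\
      u ∘ f1 = h1 ∘ g /\ h2 ∘ u = f2 /\
      v ∘ h1 = g1 /\ g2 ∘ v = fmap shift f ∘ h2
}.

Arguments shift {_} _.
Arguments dist {_} _ {_ _ _} _ _ _.

Record TriFunctor (C D : Category) (TC : Triangulated C) (TD : Triangulated D)
    (F : Functor C D) : Type := {
  tf_shift :> NatIso (F ⊚ shift TC) (shift TD ⊚ F);
  tf_additive : additive_functor TC TD F;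
  tf_dist : forall (X Y Z : C) (f : X ~> Y) (g : Y ~> Z) (h : Z ~> shift TC X),
    dist TC f g h -> dist TD (fmap F f) (fmap F g) (tf_shift X ∘ fmap F h)
}.

Definition tri_shift (C D : Category) (TC : Triangulated C)
    (TD : Triangulated D) (F : Functor C D) (tF : TriFunctor TC TD F) (X : C) :
    F (shift TC X) ~> shift TD (F X) :=
  tF X.

Definition comp_shift (C D E : Category) (TC : Triangulated C)
    (TD : Triangulated D) (TE : Triangulated E) (F : Functor C D)
    (G : Functor D E) (tG : TriFunctor TD TE G) (tF : TriFunctor TC TD F)
    (X : C) : (G ⊚ F) (shift TC X) ~> shift TE ((G ⊚ F) X) :=
  tG (F X) ∘ fmap G (tF X).

(* A transformation of triangulated functors commutes with the isomorphisms
   [sF], [sG] exchanging the functors with the translations. *)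
Definition tri_natural (C D : Category) (TC : Triangulated C)
    (TD : Triangulated D) (F G : Functor C D)
    (sF : forall X, F (shift TC X) ~> shift TD (F X))
    (sG : forall X, G (shift TC X) ~> shift TD (G X))
    (alpha : NatIso F G) : Prop :=
  forall X, sG X ∘ alpha (shift TC X) = fmap (shift TD) (alpha X) ∘ sF X.

(* The convention of Kashiwara-Schapira, "Categories and Sheaves", Chapter 10:
   triangulated in each variable, and the two ways of moving both translations
   outside differ by the sign -1. *)
Record BiTriFunctor (C D E : Category) (TC : Triangulated C)
    (TD : Triangulated D) (TE : Triangulated E) (F : Functor (C ×c D) E) : Type := {
  bt_shift_l : NatIso (F ⊚ Fprod (shift TC) (Fid D)) (shift TE ⊚ F);
  bt_shift_r : NatIso (F ⊚ Fprod (Fid C) (shift TD)) (shift TE ⊚ F);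
  bt_additive_l : forall B : D, additive_functor TC TE (F ⊚ pair_r C B);
  bt_additive_r : forall A : C, additive_functor TD TE (F ⊚ pair_l D A);
  bt_dist_l : forall (B : D) (X Y Z : C)
      (f : X ~> Y) (g : Y ~> Z) (h : Z ~> shift TC X),
    dist TC f g h ->
    dist TE (bmap F f (idm B)) (bmap F g (idm B))
      (bt_shift_l (X, B) ∘ bmap F h (idm B));
  bt_dist_r : forall (A : C) (X Y Z : D)
      (f : X ~> Y) (g : Y ~> Z) (h : Z ~> shift TD X),
    dist TD f g h ->
    dist TE (bmap F (idm A) f) (bmap F (idm A) g)
      (bt_shift_r (A, X) ∘ bmap F (idm A) h);
  bt_anticommute : forall (A : C) (B : D),
    fmap (shift TE) (bt_shift_r (A, B)) ∘ bt_shift_l (A, shift TD B) =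
    hopp TE (fmap (shift TE) (bt_shift_l (A, B)) ∘ bt_shift_r (shift TC A, B))
}.

(* [alpha : K A ⊗ K B -> K (A ⊗ B)] is an isomorphism of bi-triangulated
   functors; used both for K = f^* and for K = R_S. *)
Definition bitri_natural (C D : Category) (TC : Triangulated C)
    (TD : Triangulated D) (K : Functor C D) (tK : TriFunctor TC TD K)
    (F : Functor (C ×c C) C) (bF : BiTriFunctor TC TC TC F)
    (G : Functor (D ×c D) D) (bG : BiTriFunctor TD TD TD G)
    (alpha : NatIso (G ⊚ Fprod K K) (K ⊚ F)) : Prop :=
  forall A B : C,
    tK (F (A, B)) ∘ fmap K (bt_shift_l bF (A, B)) ∘ alpha (shift TC A, B) =
    fmap (shift TD) (alpha (A, B)) ∘
      (bt_shift_l bG (K A, K B) ∘ bmap G (tK A) (idm (K B))) /\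
    tK (F (A, B)) ∘ fmap K (bt_shift_r bF (A, B)) ∘ alpha (A, shift TC B) =
    fmap (shift TD) (alpha (A, B)) ∘
      (bt_shift_r bG (K A, K B) ∘ bmap G (idm (K A)) (tK B)).

Definition is_pullback (C : Category) (P S T W : C) (p : P ~> S) (f : T ~> S)
    (f' : W ~> P) (p' : W ~> T) : Prop :=
  p ∘ f' = f ∘ p' /\
  forall (X : C) (a : X ~> P) (b : X ~> T), p ∘ a = f ∘ b ->
    exists! h : X ~> W, f' ∘ h = a /\ p' ∘ h = b.

Definition is_product (C : Category) (A B W : C) (p : W ~> A) (q : W ~> B) : Prop :=
  forall (X : C) (a : X ~> A) (b : X ~> B),
    exists! h : X ~> W, p ∘ h = a /\ q ∘ h = b.

Record Base : Type := {
  bcat :> Category;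
  final : bcat;
  to_final : forall X : bcat, X ~> final;
  to_final_unique : forall (X : bcat) (f : X ~> final), f = to_final X;
  has_products : forall A B : bcat,
    exists (W : bcat) (p : W ~> A) (q : W ~> B), is_product p q;
  smooth : forall X Y : bcat, X ~> Y -> Prop;
  closed_imm : forall X Y : bcat, X ~> Y -> Prop;
  smooth_iso : forall (X Y : bcat) (f : X ~> Y), is_iso f -> smooth f;
  smooth_comp : forall (X Y Z : bcat) (f : X ~> Y) (g : Y ~> Z),
    smooth f -> smooth g -> smooth (g ∘ f);
  closed_iso : forall (X Y : bcat) (f : X ~> Y), is_iso f -> closed_imm f;
  closed_comp : forall (X Y Z : bcat) (f : X ~> Y) (g : Y ~> Z),
    closed_imm f -> closed_imm g -> closed_imm (g ∘ f);
  smooth_pullback_exists : forall (P S T : bcat) (p : P ~> S) (f : T ~> S),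
    smooth p ->
    exists (W : bcat) (f' : W ~> P) (p' : W ~> T), is_pullback p f f' p';
  smooth_pullback : forall (P S T W : bcat) (p : P ~> S) (f : T ~> S)
      (f' : W ~> P) (p' : W ~> T),
    smooth p -> is_pullback p f f' p' -> smooth p';
  closed_pullback : forall (P S Z W : bcat) (p : P ~> S) (z : Z ~> S)
      (z' : W ~> P) (p' : W ~> Z),
    smooth p -> closed_imm z -> is_pullback p z z' p' -> closed_imm z';
  closed_cancel : forall (Z S V : bcat) (z : Z ~> S) (g : S ~> V),
    closed_imm (g ∘ z) -> closed_imm z;
  factorization : forall (T S : bcat) (f : T ~> S),
    exists (P : bcat) (t : T ~> P) (p : P ~> S),
      closed_imm t /\ smooth p /\ f = p ∘ t;
  initial : bcat;
  from_initial : forall X : bcat, initial ~> X;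
  from_initial_unique : forall (X : bcat) (f : initial ~> X), f = from_initial X;
  open_compl : forall (Z S : bcat) (z : Z ~> S), closed_imm z -> bcat;
  open_imm : forall (Z S : bcat) (z : Z ~> S) (hz : closed_imm z),
    open_compl hz ~> S;
  open_imm_smooth : forall (Z S : bcat) (z : Z ~> S) (hz : closed_imm z),
    smooth (open_imm hz);
  open_imm_mono : forall (Z S : bcat) (z : Z ~> S) (hz : closed_imm z)
      (T : bcat) (g h : T ~> open_compl hz),
    open_imm hz ∘ g = open_imm hz ∘ h -> g = h;
  open_imm_image : forall (Z S : bcat) (z : Z ~> S) (hz : closed_imm z)
      (T : bcat) (f : T ~> S),
    (exists g : T ~> open_compl hz, open_imm hz ∘ g = f) <->
    is_pullback z f (from_initial Z) (from_initial T);
  (* Indices are shifted by one: [Zs 0] is Z_{-1} and [Zs (n + 1)] is Z_n. The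
     terms beyond Z_n carry no information (repeat Z_n with identity maps). *)
  stratification : forall S : bcat,
    exists (n : nat) (Zs : nat -> bcat) (z : forall r, Zs r ~> Zs (Datatypes.S r))
        (hz : forall r, closed_imm (z r)),
      Zs 0 = initial /\ Zs (Datatypes.S n) = S /\
      forall r, r <= n -> smooth (to_final (open_compl (hz r)))
}.

Arguments to_final {_} _.
Arguments smooth {_ _ _} _.
Arguments closed_imm {_ _ _} _.
Arguments initial {_}.
Arguments open_compl {_ _ _ _} _.
Arguments open_imm {_ _ _ _} _.

Definition in_U (B : Base) (Y : B) : Prop := smooth (to_final Y).

Arguments in_U : clear implicits.



Record FibCat (C : Category) : Type := {
  fib :> C -> Category;
  pull : forall (T S : C) (f : T ~> S), Functor (fib S) (fib T);
  conn : forall (T S V : C) (f : T ~> S) (g : S ~> V),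
    NatIso (pull (g ∘ f)) (pull f ⊚ pull g);
  pull_id : forall S : C, pull (idm S) = Fid (fib S);
  conn_cocycle : forall (T S V W : C) (f : T ~> S) (g : S ~> V) (h : V ~> W)
      (A : fib W),
    conn f g (pull h A) ∘ conn (g ∘ f) h A =
    fmap (pull f) (conn g h A) ∘ conn f (h ∘ g) A ∘
      eq_hom (f_equal (fun k => pull k A) (comp_assoc f g h))
}.

Arguments pull {_ _ _ _} _.
Arguments conn {_ _ _ _ _} _ _.

Record TriFibCat (C : Category) : Type := {
  tfib :> FibCat C;
  tri : forall S : C, Triangulated (tfib S);
  pull_tri : forall (T S : C) (f : T ~> S),
    TriFunctor (tri S) (tri T) (pull f);
  conn_tri : forall (T S V : C) (f : T ~> S) (g : S ~> V),
    tri_natural (tri_shift (pull_tri (g ∘ f)))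
      (comp_shift (pull_tri f) (pull_tri g)) (conn f g)
}.

Arguments tri {_} _ _.
Arguments pull_tri {_} _ {_ _} _.

(* The composite p'_# f'^* A -> p'_# f'^* p^* p_# A = p'_# p'^* f^* p_# A
   -> f^* p_# A of a commutative square [sq]. *)
Definition base_change (C : Category) (H : FibCat C) (P S T W : C)
    (p : P ~> S) (f : T ~> S) (f' : W ~> P) (p' : W ~> T)
    (sq : p ∘ f' = f ∘ p')
    (ps : Functor (H P) (H S)) (adj : Adjunction ps (pull p))
    (ps' : Functor (H W) (H T)) (adj' : Adjunction ps' (pull p'))
    (A : H P) : ps' (pull f' A) ~> pull f (ps A) :=
  adj_counit adj' (pull f (ps A)) ∘
  fmap ps'
    (conn p' f (ps A) ∘
     eq_hom (f_equal (fun k => pull k (ps A)) sq) ∘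
     bwd (conn f' p (ps A)) ∘
     fmap (pull f') (adj_unit adj A)).

(* [lsharp] is p_# and [push] is z_*; choosing the adjoints is harmless, since
   they are unique up to unique isomorphism. *)
Record LocalicFibCat (B : Base) : Type := {
  lfib :> TriFibCat B;
  loc_empty : forall A : lfib initial, zero_object (tri lfib initial) A;
  lsharp : forall (P S : B) (p : P ~> S), smooth p -> Functor (lfib P) (lfib S);
  lsharp_adj : forall (P S : B) (p : P ~> S) (hp : smooth p),
    Adjunction (lsharp hp) (pull p);
  lsharp_base_change : forall (P S T W : B) (p : P ~> S) (f : T ~> S)
      (f' : W ~> P) (p' : W ~> T) (hp : smooth p) (hp' : smooth p')
      (sq : p ∘ f' = f ∘ p'),
    is_pullback p f f' p' ->
    forall A : lfib P,
      is_iso (base_change sq (lsharp_adj hp) (lsharp_adj hp') A);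
  push : forall (Z S : B) (z : Z ~> S), closed_imm z -> Functor (lfib Z) (lfib S);
  push_adj : forall (Z S : B) (z : Z ~> S) (hz : closed_imm z),
    Adjunction (pull z) (push hz);
  push_ff : forall (Z S : B) (z : Z ~> S) (hz : closed_imm z),
    fully_faithful (push hz);
  loc_conservative : forall (Z S : B) (z : Z ~> S) (hz : closed_imm z)
      (A A' : lfib S) (f : A ~> A'),
    is_iso (fmap (pull z) f) -> is_iso (fmap (pull (open_imm hz)) f) -> is_iso f
}.

Arguments lsharp {_} _ {_ _ _} _.
Arguments lsharp_adj {_} _ {_ _ _} _.

Record FibMor (C : Category) (H1 H2 : FibCat C) : Type := {
  mor :> forall S : C, Functor (H1 S) (H2 S);
  theta : forall (T S : C) (f : T ~> S),
    NatIso (pull f ⊚ mor S) (mor T ⊚ pull f);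
  theta_cocycle : forall (T S V : C) (f : T ~> S) (g : S ~> V) (A : H1 V),
    fmap (mor T) (conn f g A) ∘ theta (g ∘ f) A =
    theta f (pull g A) ∘ fmap (pull f) (theta g A) ∘ conn f g (mor V A)
}.

Arguments theta {_ _ _} _ {_ _} _.

Record TriFibMor (C : Category) (H1 H2 : TriFibCat C) : Type := {
  tmor :> FibMor H1 H2;
  mor_tri : forall S : C, TriFunctor (tri H1 S) (tri H2 S) (tmor S);
  theta_tri : forall (T S : C) (f : T ~> S),
    tri_natural (comp_shift (pull_tri H2 f) (mor_tri S))
      (comp_shift (mor_tri T) (pull_tri H1 f)) (theta tmor f)
}.

Arguments mor_tri {_ _ _} _ _.

Definition mor_exchange (C : Category) (H1 H2 : FibCat C) (R : FibMor H1 H2)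
    (P S : C) (p : P ~> S)
    (ps1 : Functor (H1 P) (H1 S)) (adj1 : Adjunction ps1 (pull p))
    (ps2 : Functor (H2 P) (H2 S)) (adj2 : Adjunction ps2 (pull p))
    (A : H1 P) : ps2 (R P A) ~> R S (ps1 A) :=
  adj_counit adj2 (R S (ps1 A)) ∘
  fmap ps2 (bwd (theta R p (ps1 A)) ∘ fmap (R P) (adj_unit adj1 A)).

Record LocalicFibMor (B : Base) (H1 H2 : LocalicFibCat B) : Type := {
  lmor :> TriFibMor H1 H2;
  lmor_exchange : forall (P S : B) (p : P ~> S) (hp : smooth p) (A : H1 P),
    is_iso (mor_exchange lmor (lsharp_adj H1 hp) (lsharp_adj H2 hp) A)
}.

Record Tensor (C : Category) (H : FibCat C) : Type := {
  ten : forall S : C, Functor (H S ×c H S) (H S);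
  ten_m : forall (T S : C) (f : T ~> S),
    NatIso (ten T ⊚ Fprod (pull f) (pull f)) (pull f ⊚ ten S);
  ten_cocycle : forall (T S V : C) (f : T ~> S) (g : S ~> V) (A B : H V),
    conn f g (ten V (A, B)) ∘ ten_m (g ∘ f) (A, B) =
    fmap (pull f) (ten_m g (A, B)) ∘ ten_m f (pull g A, pull g B) ∘
      bmap (ten T) (conn f g A) (conn f g B)
}.

Arguments ten {_ _} _ _.
Arguments ten_m {_ _} _ {_ _} _.

Notation "A ⊗[ t ] B" := (bobj (ten t _) A B)
  (at level 35, right associativity, format "A  ⊗[ t ]  B").
Notation "f ⊗m[ t ] g" := (bmap (ten t _) f g)
  (at level 35, right associativity, format "f  ⊗m[ t ]  g").

Record TriTensor (C : Category) (H : TriFibCat C) : Type := {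
  tten :> Tensor H;
  ten_tri : forall S : C, BiTriFunctor (tri H S) (tri H S) (tri H S) (ten tten S);
  ten_m_tri : forall (T S : C) (f : T ~> S),
    bitri_natural (pull_tri H f) (ten_tri S) (ten_tri T) (ten_m tten f)
}.

Arguments ten_tri {_ _} _ _.

Definition proj_formula_l (C : Category) (H : FibCat C) (t : Tensor H)
    (P S : C) (p : P ~> S) (ps : Functor (H P) (H S))
    (adj : Adjunction ps (pull p)) (A : H P) (B : H S) :
    ps (A ⊗[t] pull p B) ~> ps A ⊗[t] B :=
  adj_counit adj (ps A ⊗[t] B) ∘
  fmap ps (ten_m t p (ps A, B) ∘ (adj_unit adj A ⊗m[t] idm (pull p B))).

Definition proj_formula_r (C : Category) (H : FibCat C) (t : Tensor H)
    (P S : C) (p : P ~> S) (ps : Functor (H P) (H S))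
    (adj : Adjunction ps (pull p)) (A : H S) (B : H P) :
    ps (pull p A ⊗[t] B) ~> A ⊗[t] ps B :=
  adj_counit adj (A ⊗[t] ps B) ∘
  fmap ps (ten_m t p (A, ps B) ∘ (idm (pull p A) ⊗m[t] adj_unit adj B)).

Record LocalicTensor (B : Base) (H : LocalicFibCat B) : Type := {
  lten :> TriTensor H;
  lten_proj_l : forall (P S : B) (p : P ~> S) (hp : smooth p) (X : H P) (Y : H S),
    is_iso (proj_formula_l lten (lsharp_adj H hp) X Y);
  lten_proj_r : forall (P S : B) (p : P ~> S) (hp : smooth p) (X : H S) (Y : H P),
    is_iso (proj_formula_r lten (lsharp_adj H hp) X Y)
}.

Record TensorMor (C : Category) (H1 H2 : FibCat C) (R : FibMor H1 H2)
    (t1 : Tensor H1) (t2 : Tensor H2) : Type := {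
  rho_app :> forall S : C, NatIso (ten t2 S ⊚ Fprod (R S) (R S)) (R S ⊚ ten t1 S);
  rho_pull : forall (T S : C) (f : T ~> S) (A B : H1 S),
    theta R f (A ⊗[t1] B) ∘ fmap (pull f) (rho_app S (A, B)) ∘
      ten_m t2 f (R S A, R S B) =
    fmap (R T) (ten_m t1 f (A, B)) ∘ rho_app T (pull f A, pull f B) ∘
      (theta R f A ⊗m[t2] theta R f B)
}.

Definition rho_triangulated (C : Category) (H1 H2 : TriFibCat C)
    (R : TriFibMor H1 H2) (t1 : TriTensor H1) (t2 : TriTensor H2)
    (rho : TensorMor R t1 t2) : Prop :=
  forall S : C,
    bitri_natural (mor_tri R S) (ten_tri t1 S) (ten_tri t2 S) (rho S).

Record AssocConstraint (C : Category) (H : FibCat C) (t : Tensor H) : Type := {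
  ac :> forall S : C,
    NatIso (ten t S ⊚ Fprod (ten t S) (Fid (H S)))
      (ten t S ⊚ Fprod (Fid (H S)) (ten t S) ⊚ Fassoc (H S) (H S) (H S));
  ac_pentagon : forall (S : C) (A B D E : H S),
    ac S ((A, B), D ⊗[t] E) ∘ ac S ((A ⊗[t] B, D), E) =
    (idm A ⊗m[t] ac S ((B, D), E)) ∘ ac S ((A, B ⊗[t] D), E) ∘
      (ac S ((A, B), D) ⊗m[t] idm E);
  ac_pull : forall (T S : C) (f : T ~> S) (A B D : H S),
    fmap (pull f) (ac S ((A, B), D)) ∘ ten_m t f (A ⊗[t] B, D) ∘
      (ten_m t f (A, B) ⊗m[t] idm (pull f D)) =
    ten_m t f (A, B ⊗[t] D) ∘ (idm (pull f A) ⊗m[t] ten_m t f (B, D)) ∘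
      ac T ((pull f A, pull f B), pull f D)
}.

Record CommConstraint (C : Category) (H : FibCat C) (t : Tensor H) : Type := {
  cc :> forall S : C, NatIso (ten t S) (ten t S ⊚ Fswap (H S) (H S));
  cc_involutive : forall (S : C) (A B : H S),
    cc S (B, A) ∘ cc S (A, B) = idm (A ⊗[t] B);
  cc_pull : forall (T S : C) (f : T ~> S) (A B : H S),
    ten_m t f (B, A) ∘ cc T (pull f A, pull f B) =
    fmap (pull f) (cc S (A, B)) ∘ ten_m t f (A, B)
}.

Record FibSection (C : Category) (H : FibCat C) : Type := {
  sec :> forall S : C, H S;
  sec_pull : forall (T S : C) (f : T ~> S), Iso (pull f (sec S)) (sec T);
  sec_cocycle : forall (V T S : C) (f : V ~> T) (g : T ~> S),
    fwd (sec_pull (g ∘ f)) =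
    sec_pull f ∘ fmap (pull f) (sec_pull g) ∘ conn f g (sec S)
}.

Arguments sec_pull {_ _} _ {_ _} _.

Record SectionIso (C : Category) (H : FibCat C) (A B : FibSection H) : Type := {
  sec_iso :> forall S : C, Iso (A S) (B S);
  sec_iso_pull : forall (T S : C) (f : T ~> S),
    sec_pull B f ∘ fmap (pull f) (sec_iso S) = sec_iso T ∘ sec_pull A f
}.

Definition image_section (C : Category) (H1 H2 : FibCat C) (R : FibMor H1 H2)
    (A : FibSection H1) : FibSection H2.
Proof.
refine {|
  sec := fun S => R S (A S);
  sec_pull := fun T S f =>
    iso_comp (fmap_iso (R T) (sec_pull A f)) (theta R f (A S))
|}.
intros V T S f g; simpl.
rewrite sec_cocycle, !fmap_comp.
rewrite <- (comp_assoc (theta R (g ∘ f) (A S))), theta_cocycle.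
simpl; rewrite !comp_assoc.
pose proof (ni_natural (theta R f) (sec_pull A g)) as E; simpl in E.
rewrite <- (comp_assoc _ (theta R f (A T)) (fmap (R V) (sec_pull A f))).
refine (eq_trans _ (f_equal (fun k => fmap (R V) (sec_pull A f) ∘ k ∘ _ ∘ _)
  (eq_sym E))).
rewrite !comp_assoc; reflexivity.
Defined.

Record UnitConstraint (C : Category) (H : FibCat C) (t : Tensor H) : Type := {
  uc_sec : FibSection H;
  uc_r : forall S : C, NatIso (ten t S ⊚ pair_r (H S) (uc_sec S)) (Fid (H S));
  uc_l : forall S : C, NatIso (ten t S ⊚ pair_l (H S) (uc_sec S)) (Fid (H S));
  uc_agree : forall S : C, fwd (uc_r S (uc_sec S)) = fwd (uc_l S (uc_sec S));
  uc_r_pull : forall (T S : C) (f : T ~> S) (A : H S),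
    uc_r T (pull f A) ∘ (idm (pull f A) ⊗m[t] sec_pull uc_sec f) =
    fmap (pull f) (uc_r S A) ∘ ten_m t f (A, uc_sec S);
  uc_l_pull : forall (T S : C) (f : T ~> S) (B : H S),
    uc_l T (pull f B) ∘ (sec_pull uc_sec f ⊗m[t] idm (pull f B)) =
    fmap (pull f) (uc_l S B) ∘ ten_m t f (uc_sec S, B)
}.

Arguments uc_sec {_ _ _} _.
Arguments uc_r {_ _ _} _ _.
Arguments uc_l {_ _ _} _ _.

Definition rho_associative (C : Category) (H1 H2 : FibCat C) (R : FibMor H1 H2)
    (t1 : Tensor H1) (t2 : Tensor H2) (rho : TensorMor R t1 t2)
    (a1 : AssocConstraint t1) (a2 : AssocConstraint t2) : Prop :=
  forall (S : C) (A B D : H1 S),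
    fmap (R S) (a1 S ((A, B), D)) ∘ rho S (A ⊗[t1] B, D) ∘
      (rho S (A, B) ⊗m[t2] idm (R S D)) =
    rho S (A, B ⊗[t1] D) ∘ (idm (R S A) ⊗m[t2] rho S (B, D)) ∘
      a2 S ((R S A, R S B), R S D).

Definition rho_symmetric (C : Category) (H1 H2 : FibCat C) (R : FibMor H1 H2)
    (t1 : Tensor H1) (t2 : Tensor H2) (rho : TensorMor R t1 t2)
    (c1 : CommConstraint t1) (c2 : CommConstraint t2) : Prop :=
  forall (S : C) (A B : H1 S),
    fmap (R S) (c1 S (A, B)) ∘ rho S (A, B) =
    rho S (B, A) ∘ c2 S (R S A, R S B).

Definition rho_unitary (C : Category) (H1 H2 : FibCat C) (R : FibMor H1 H2)
    (t1 : Tensor H1) (t2 : Tensor H2) (rho : TensorMor R t1 t2)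
    (u1 : UnitConstraint t1) (u2 : UnitConstraint t2)
    (w : SectionIso (image_section R (uc_sec u1)) (uc_sec u2)) : Prop :=
  (forall (S : C) (A : H1 S),
    fmap (R S) (uc_r u1 S A) ∘ rho S (A, uc_sec u1 S) =
    uc_r u2 S (R S A) ∘ (idm (R S A) ⊗m[t2] w S)) /\
  (forall (S : C) (B : H1 S),
    fmap (R S) (uc_l u1 S B) ∘ rho S (uc_sec u1 S, B) =
    uc_l u2 S (R S B) ∘ (w S ⊗m[t2] idm (R S B))).

Arguments rho_associative {_ _ _ _ _ _} _ _ _.
Arguments rho_symmetric {_ _ _ _ _ _} _ _ _.
Arguments rho_unitary {_ _ _ _ _ _} _ _ _ _.

Section Restriction.

Context (C : Category) (P : C -> Prop).

Local Notation val := proj1_sig.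

Definition restr_fib (H : FibCat C) : FibCat (full_sub P) :=
  @Build_FibCat (full_sub P) (fun X => H (val X))
    (fun T S f => @pull C H (val T) (val S) f)
    (fun T S V f g => @conn C H (val T) (val S) (val V) f g)
    (fun S => pull_id H (val S))
    (fun T S V W f g h => @conn_cocycle C H (val T) (val S) (val V) (val W) f g h).

Definition restr_tri (H : TriFibCat C) : TriFibCat (full_sub P) :=
  @Build_TriFibCat (full_sub P) (restr_fib H)
    (fun X => tri H (val X))
    (fun T S f => @pull_tri C H (val T) (val S) f)
    (fun T S V f g => @conn_tri C H (val T) (val S) (val V) f g).

Definition restr_mor (H1 H2 : FibCat C) (R : FibMor H1 H2) :
    FibMor (restr_fib H1) (restr_fib H2) :=
  @Build_FibMor (full_sub P) (restr_fib H1) (restr_fib H2)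
    (fun X => R (val X))
    (fun T S f => @theta C H1 H2 R (val T) (val S) f)
    (fun T S V f g => @theta_cocycle C H1 H2 R (val T) (val S) (val V) f g).

Definition restr_trimor (H1 H2 : TriFibCat C) (R : TriFibMor H1 H2) :
    TriFibMor (restr_tri H1) (restr_tri H2) :=
  @Build_TriFibMor (full_sub P) (restr_tri H1) (restr_tri H2)
    (restr_mor R)
    (fun X => mor_tri R (val X))
    (fun T S f => @theta_tri C H1 H2 R (val T) (val S) f).

Definition restr_tensor (H : FibCat C) (t : Tensor H) : Tensor (restr_fib H) :=
  @Build_Tensor (full_sub P) (restr_fib H)
    (fun X => ten t (val X))
    (fun T S f => @ten_m C H t (val T) (val S) f)
    (fun T S V f g => @ten_cocycle C H t (val T) (val S) (val V) f g).

Definition restr_tritensor (H : TriFibCat C) (t : TriTensor H) :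
    TriTensor (restr_tri H) :=
  @Build_TriTensor (full_sub P) (restr_tri H)
    (restr_tensor t)
    (fun X => ten_tri t (val X))
    (fun T S f => @ten_m_tri C H t (val T) (val S) f).

Definition restr_rho (H1 H2 : FibCat C) (R : FibMor H1 H2) (t1 : Tensor H1)
    (t2 : Tensor H2) (rho : TensorMor R t1 t2) :
    TensorMor (restr_mor R) (restr_tensor t1) (restr_tensor t2) :=
  @Build_TensorMor (full_sub P) (restr_fib H1) (restr_fib H2) (restr_mor R)
    (restr_tensor t1) (restr_tensor t2)
    (fun X => rho (val X))
    (fun T S f => @rho_pull C H1 H2 R t1 t2 rho (val T) (val S) f).

Definition restr_assoc (H : FibCat C) (t : Tensor H) (a : AssocConstraint t) :
    AssocConstraint (restr_tensor t) :=
  @Build_AssocConstraint (full_sub P) (restr_fib H) (restr_tensor t)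
    (fun X => a (val X))
    (fun X => @ac_pentagon C H t a (val X))
    (fun T S f => @ac_pull C H t a (val T) (val S) f).

Definition restr_comm (H : FibCat C) (t : Tensor H) (c : CommConstraint t) :
    CommConstraint (restr_tensor t) :=
  @Build_CommConstraint (full_sub P) (restr_fib H) (restr_tensor t)
    (fun X => c (val X))
    (fun X => @cc_involutive C H t c (val X))
    (fun T S f => @cc_pull C H t c (val T) (val S) f).

Definition restr_section (H : FibCat C) (A : FibSection H) :
    FibSection (restr_fib H) :=
  @Build_FibSection (full_sub P) (restr_fib H)
    (fun X => A (val X))
    (fun T S f => @sec_pull C H A (val T) (val S) f)
    (fun V T S f g => @sec_cocycle C H A (val V) (val T) (val S) f g).

Definition restr_unit (H : FibCat C) (t : Tensor H) (u : UnitConstraint t) :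
    UnitConstraint (restr_tensor t) :=
  @Build_UnitConstraint (full_sub P) (restr_fib H) (restr_tensor t)
    (restr_section (uc_sec u))
    (fun X => uc_r u (val X))
    (fun X => uc_l u (val X))
    (fun X => uc_agree u (val X))
    (fun T S f => @uc_r_pull C H t u (val T) (val S) f)
    (fun T S f => @uc_l_pull C H t u (val T) (val S) f).

(* [ww] restricts to [w]. The unit sections at the two ends of [w] are only
   propositionally equal to the restrictions of those of [uu1] and [uu2]. *)
Definition section_iso_restricts (H1 H2 : FibCat C) (R : FibMor H1 H2)
    (t1 : Tensor H1) (t2 : Tensor H2)
    (uu1 : UnitConstraint t1) (uu2 : UnitConstraint t2)
    (u1 : UnitConstraint (restr_tensor t1)) (u2 : UnitConstraint (restr_tensor t2))
    (e1 : restr_unit uu1 = u1) (e2 : restr_unit uu2 = u2)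
    (ww : SectionIso (image_section R (uc_sec uu1)) (uc_sec uu2))
    (w : SectionIso (image_section (restr_mor R) (uc_sec u1)) (uc_sec u2)) : Prop :=
  forall X : full_sub P,
    w X ∘ eq_hom (f_equal (fun u => image_section (restr_mor R) (uc_sec u) X) e1) =
    eq_hom (f_equal (fun u => uc_sec u X) e2) ∘ ww (val X).

End Restriction.

(* Main.v *)
(** Factoring [S -> ∗] as a closed immersion [z : S -> P] followed by a smooth
    morphism embeds every [S] as a closed subobject of some [P] in [U]. As [z_*]
    is fully faithful, every object over [S] is a retract of some [z^* A], so two
    natural families of morphisms, both compatible with inverse images, agree
    over [S] as soon as they agree over [P]. All three statements compare such
    families. *)

From Corelib Require Import ssreflect.
Require Import Defs.

Set Implicit Arguments.
Unset Strict Implicit.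
Unset Printing Implicit Defensive.

(** * Isomorphisms, cancellation and bifunctoriality *)

Lemma fwd_is_iso (C : Category) (A B : C) (i : Iso A B) : is_iso i.
Proof. by exists (bwd i); rewrite bwd_fwd fwd_bwd. Qed.

Lemma is_iso_id (C : Category) (A : C) : is_iso (idm A).
Proof. by exists (idm A); rewrite comp_id_l. Qed.

Lemma is_iso_comp (C : Category) (A B D : C) (g : B ~> D) (f : A ~> B) :
  is_iso g -> is_iso f -> is_iso (g ∘ f).
Proof.
move=> [g' [g'g gg']] [f' [f'f ff']]; exists (f' ∘ g'); split.
- by rewrite comp_assoc -(comp_assoc g g' f') g'g comp_id_r f'f.
- by rewrite comp_assoc -(comp_assoc f' f g) ff' comp_id_r gg'.
Qed.

Lemma is_iso_fmap (C D : Category) (F : Functor C D) (A B : C) (f : A ~> B) :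
  is_iso f -> is_iso (fmap F f).
Proof. by move=> [g [gf fg]]; exists (fmap F g); rewrite -!fmap_comp gf fg !fmap_id. Qed.

Lemma iso_mono (C : Category) (A B D : C) (i : B ~> D) (f g : A ~> B) :
  is_iso i -> i ∘ f = i ∘ g -> f = g.
Proof. by move=> [j [ji _]] E; rewrite -(comp_id_l f) -(comp_id_l g) -ji -!comp_assoc E. Qed.

Lemma iso_epi (C : Category) (A B D : C) (i : A ~> B) (f g : B ~> D) :
  is_iso i -> f ∘ i = g ∘ i -> f = g.
Proof. by move=> [j [_ ij]] E; rewrite -(comp_id_r f) -(comp_id_r g) -ij !comp_assoc E. Qed.

(** In a composite associated to the right, [g ∘ f] is not a subterm of [g ∘ (f ∘ h)]; this form
    lets an equation for [g ∘ f] be used there. *)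
Lemma comp_rewrite (C : Category) (A B D : C) (g : B ~> D) (f : A ~> B)
    (k : A ~> D) :
  g ∘ f = k -> forall (X : C) (h : X ~> A), g ∘ (f ∘ h) = k ∘ h.
Proof. by move=> E X h; rewrite comp_assoc E. Qed.

Lemma comp_rewrite3 (C : Category) (A B D E : C) (g : D ~> E) (f : B ~> D)
    (e : A ~> B) (k : A ~> E) :
  g ∘ (f ∘ e) = k -> forall (X : C) (h : X ~> A), g ∘ (f ∘ (e ∘ h)) = k ∘ h.
Proof. by move=> <- X h; rewrite !comp_assoc. Qed.

Lemma bmap_id (C D E : Category) (F : Functor (C ×c D) E) (A : C) (B : D) :
  bmap F (idm A) (idm B) = idm (bobj F A B).
Proof. exact: (fmap_id F (A, B)). Qed.

Lemma bmap_comp (C D E : Category) (F : Functor (C ×c D) E)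
    (A A' A'' : C) (B B' B'' : D)
    (f' : A' ~> A'') (f : A ~> A') (g' : B' ~> B'') (g : B ~> B') :
  bmap F (f' ∘ f) (g' ∘ g) = bmap F f' g' ∘ bmap F f g.
Proof.
exact: (@fmap_comp _ _ F (A, B) (A', B') (A'', B'') (f, g) (f', g')).
Qed.

Lemma is_iso_bmap (C D E : Category) (F : Functor (C ×c D) E)
    (A A' : C) (B B' : D) (f : A ~> A') (g : B ~> B') :
  is_iso f -> is_iso g -> is_iso (bmap F f g).
Proof.
move=> [f' [f'f ff']] [g' [g'g gg']]; exists (bmap F f' g').
by rewrite -!bmap_comp f'f ff' g'g gg' !bmap_id.
Qed.

(** * Split epimorphisms and retracts *)

Definition split_epi (C : Category) (A B : C) (r : A ~> B) : Prop :=
  exists s : B ~> A, r ∘ s = idm B.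

Lemma split_epi_fmap (C D : Category) (F : Functor C D) (A B : C) (r : A ~> B) :
  split_epi r -> split_epi (fmap F r).
Proof. by move=> [s rs]; exists (fmap F s); rewrite -fmap_comp rs fmap_id. Qed.

Lemma split_epi_bmap (C D E : Category) (F : Functor (C ×c D) E)
    (A A' : C) (B B' : D) (f : A ~> A') (g : B ~> B') :
  split_epi f -> split_epi g -> split_epi (bmap F f g).
Proof.
move=> [f' ff'] [g' gg']; exists (bmap F f' g').
by rewrite -bmap_comp ff' gg' bmap_id.
Qed.

Lemma split_epi_id (C : Category) (A : C) : split_epi (idm A).
Proof. by exists (idm A); rewrite comp_id_l. Qed.

(** A split epimorphism can be cancelled on the right, so [g ∘ a] and [g ∘ b] determine [a'] and
    [b']. In the applications [r] and [g] are induced by retractions of the objects involved. *)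
Lemma eq_on_retract (C : Category) (X X' Y Y' : C) (a b : X ~> Y)
    (a' b' : X' ~> Y') (r : X ~> X') (g : Y ~> Y') :
  split_epi r -> a' ∘ r = g ∘ a -> b' ∘ r = g ∘ b -> a = b -> a' = b'.
Proof.
move=> [s rs] Ea Eb E.
by rewrite -(comp_id_r a') -(comp_id_r b') -rs !comp_assoc Ea Eb E.
Qed.

(** Fullness writes the unit at [R B] as [fmap R s]. By the triangle identity [R] sends the counit
    composed with [s] to an identity, and faithfulness makes [s] a section of the counit. *)
Lemma counit_split_epi (C D : Category) (L : Functor C D) (R : Functor D C)
    (adj : Adjunction L R) (ffR : fully_faithful R) (B : D) :
  split_epi (adj_counit adj B).
Proof.
have [s [Es _]] := ffR _ _ (adj_unit adj (R B)).
exists s.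
have [i [_ uniq_i]] := ffR _ _ (idm (R B)).
rewrite -(uniq_i (idm B) (fmap_id R B)); symmetry; apply: uniq_i.
by rewrite fmap_comp Es; exact: adj_right.
Qed.

(** * Objects over [S] as retracts of inverse images from [in_U B] *)

Lemma closed_embedding_in_U (B : Base) (S : B) :
  exists (P : B) (z : S ~> P), in_U B P /\ closed_imm z.
Proof.
have [P [z [p [hz [hp _]]]]] := factorization (to_final S).
(* The smooth factor [p] is the structure morphism of [P], since morphisms to [final] are unique. *)
by exists P, z; split=> //; rewrite /in_U -(to_final_unique p).
Qed.

Lemma retract_of_closed_pull (B : Base) (H : LocalicFibCat B) (Z S : B)
    (z : Z ~> S) (hz : closed_imm z) (A : H Z) :
  exists (A' : H S) (r : pull z A' ~> A), split_epi r.
Proof.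
exists (push H hz A), (adj_counit (push_adj H hz) A).
exact: counit_split_epi (@push_ff _ H _ _ _ hz) A.
Qed.

(** * Naturality and base change of the structure morphisms *)

Section TensorMorphism.

Context (C : Category) (H1 H2 : FibCat C) (R : FibMor H1 H2)
  (t1 : Tensor H1) (t2 : Tensor H2) (rho : TensorMor R t1 t2).

Lemma ten_m_natural (H : FibCat C) (t : Tensor H) (T S : C) (f : T ~> S)
    (A A' B B' : H S) (x : A ~> A') (y : B ~> B') :
  ten_m t f (A', B') ∘ (fmap (pull f) x ⊗m[t] fmap (pull f) y) =
  fmap (pull f) (x ⊗m[t] y) ∘ ten_m t f (A, B).
Proof. exact: (@ni_natural _ _ _ _ (ten_m t f) (A, B) (A', B') (x, y)). Qed.

Lemma rho_natural (S : C) (A A' B B' : H1 S) (x : A ~> A') (y : B ~> B') :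
  rho S (A', B') ∘ (fmap (R S) x ⊗m[t2] fmap (R S) y) =
  fmap (R S) (x ⊗m[t1] y) ∘ rho S (A, B).
Proof. exact: (@ni_natural _ _ _ _ (rho S) (A, B) (A', B') (x, y)). Qed.

Lemma theta_natural (T S : C) (f : T ~> S) (A A' : H1 S) (x : A ~> A') :
  theta R f A' ∘ fmap (pull f) (fmap (R S) x) =
  fmap (R T) (fmap (pull f) x) ∘ theta R f A.
Proof. exact: (ni_natural (theta R f) x). Qed.

Lemma assoc_natural (H : FibCat C) (t : Tensor H) (a : AssocConstraint t)
    (S : C) (A A' B B' D D' : H S) (x : A ~> A') (y : B ~> B') (z : D ~> D') :
  a S ((A', B'), D') ∘ ((x ⊗m[t] y) ⊗m[t] z) =
  (x ⊗m[t] (y ⊗m[t] z)) ∘ a S ((A, B), D).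
Proof. exact: (@ni_natural _ _ _ _ (a S) (A, B, D) (A', B', D') (x, y, z)). Qed.

Lemma comm_natural (H : FibCat C) (t : Tensor H) (c : CommConstraint t)
    (S : C) (A A' B B' : H S) (x : A ~> A') (y : B ~> B') :
  c S (A', B') ∘ (x ⊗m[t] y) = (y ⊗m[t] x) ∘ c S (A, B).
Proof. exact: (@ni_natural _ _ _ _ (c S) (A, B) (A', B') (x, y)). Qed.

Lemma unit_r_natural (H : FibCat C) (t : Tensor H) (u : UnitConstraint t)
    (S : C) (A A' : H S) (x : A ~> A') :
  uc_r u S A' ∘ (x ⊗m[t] idm (uc_sec u S)) = x ∘ uc_r u S A.
Proof. exact: (ni_natural (uc_r u S) x). Qed.

Lemma unit_l_natural (H : FibCat C) (t : Tensor H) (u : UnitConstraint t)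
    (S : C) (A A' : H S) (x : A ~> A') :
  uc_l u S A' ∘ (idm (uc_sec u S) ⊗m[t] x) = x ∘ uc_l u S A.
Proof. exact: (ni_natural (uc_l u S) x). Qed.

Lemma rho_pull_r (T S : C) (f : T ~> S) (A B : H1 S) :
  fmap (R T) (ten_m t1 f (A, B)) ∘
    (rho T (pull f A, pull f B) ∘ (theta R f A ⊗m[t2] theta R f B)) =
  theta R f (A ⊗[t1] B) ∘
    (fmap (pull f) (rho S (A, B)) ∘ ten_m t2 f (R S A, R S B)).
Proof. by rewrite !comp_assoc rho_pull. Qed.

(** The conditions are stated at fixed objects so that they can be transported, first to inverse
    images and then to retracts. *)
Definition associative_at (a1 : AssocConstraint t1) (a2 : AssocConstraint t2)
    (S : C) (A B D : H1 S) : Prop :=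
  fmap (R S) (a1 S ((A, B), D)) ∘ rho S (A ⊗[t1] B, D) ∘
      (rho S (A, B) ⊗m[t2] idm (R S D)) =
    rho S (A, B ⊗[t1] D) ∘ (idm (R S A) ⊗m[t2] rho S (B, D)) ∘
      a2 S ((R S A, R S B), R S D).

Definition symmetric_at (c1 : CommConstraint t1) (c2 : CommConstraint t2)
    (S : C) (A B : H1 S) : Prop :=
  fmap (R S) (c1 S (A, B)) ∘ rho S (A, B) = rho S (B, A) ∘ c2 S (R S A, R S B).

Definition unitary_r_at (u1 : UnitConstraint t1) (u2 : UnitConstraint t2)
    (w : SectionIso (image_section R (uc_sec u1)) (uc_sec u2))
    (S : C) (A : H1 S) : Prop :=
  fmap (R S) (uc_r u1 S A) ∘ rho S (A, uc_sec u1 S) =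
    uc_r u2 S (R S A) ∘ (idm (R S A) ⊗m[t2] w S).

Definition unitary_l_at (u1 : UnitConstraint t1) (u2 : UnitConstraint t2)
    (w : SectionIso (image_section R (uc_sec u1)) (uc_sec u2))
    (S : C) (B : H1 S) : Prop :=
  fmap (R S) (uc_l u1 S B) ∘ rho S (uc_sec u1 S, B) =
    uc_l u2 S (R S B) ∘ (w S ⊗m[t2] idm (R S B)).

(** * Associativity *)

(** The diagrams over [S] and [T] are the ends of a prism whose sides commute by [rho_pull],
    [ac_pull] and naturality. The edges joining the ends are built from [m] and [theta], hence
    invertible, so commutativity passes from one end to the other. *)
Lemma associative_at_pull (a1 : AssocConstraint t1) (a2 : AssocConstraint t2)
    (T S : C) (f : T ~> S) (A B D : H1 S) :
  associative_at a1 a2 A B D ->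
  associative_at a1 a2 (pull f A) (pull f B) (pull f D).
Proof.
rewrite /associative_at => E.
have iso_theta : is_iso
    ((theta R f A ⊗m[t2] theta R f B) ⊗m[t2] theta R f D).
  by do 2?[apply: is_iso_bmap]; apply: fwd_is_iso.
have iso_m : is_iso (fmap (R T)
    (ten_m t1 f (A, B ⊗[t1] D) ∘ (idm (pull f A) ⊗m[t1] ten_m t1 f (B, D)))).
  apply: is_iso_fmap; apply: is_iso_comp; first exact: fwd_is_iso.
  by apply: is_iso_bmap; [exact: is_iso_id | exact: fwd_is_iso].
apply: (iso_epi iso_theta); apply: (iso_mono iso_m).
(* The middle term is the inverse image of the left side of [E], preceded by [m] of [t2] and
   followed by [theta]; [E] then exchanges it for the right side. *)
transitivity (theta R f (A ⊗[t1] (B ⊗[t1] D))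
  ∘ fmap (pull f) (fmap (R S) (a1 S ((A, B), D)) ∘ rho S (A ⊗[t1] B, D) ∘
      (rho S (A, B) ⊗m[t2] idm (R S D)))
  ∘ ten_m t2 f (R S A ⊗[t2] R S B, R S D)
  ∘ (ten_m t2 f (R S A, R S B) ⊗m[t2] idm (pull f (R S D)))).
(* This is [rho_pull] for [A] and [B], tensored with [theta] on [D]. Identities appear as images
   under [fmap] so that naturality of [rho] and of [m] applies. *)
- have pull_AB : (fmap (R T) (ten_m t1 f (A, B)) ⊗m[t2] fmap (R T) (idm (pull f D)))
      ∘ ((rho T (pull f A, pull f B) ⊗m[t2] idm (R T (pull f D)))
      ∘ ((theta R f A ⊗m[t2] theta R f B) ⊗m[t2] theta R f D)) =
    (theta R f (A ⊗[t1] B) ⊗m[t2] theta R f D)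
      ∘ ((fmap (pull f) (rho S (A, B)) ⊗m[t2] fmap (pull f) (idm (R S D)))
      ∘ (ten_m t2 f (R S A, R S B) ⊗m[t2] idm (pull f (R S D)))).
    by rewrite -!bmap_comp rho_pull_r !fmap_id !comp_id_l comp_id_r.
  rewrite !comp_assoc -fmap_comp -ac_pull !fmap_comp -!comp_assoc.
  rewrite (comp_rewrite (eq_sym (rho_natural _ _))) -!comp_assoc pull_AB.
  rewrite (comp_rewrite3 (rho_pull_r _ _ _)) -!comp_assoc.
  rewrite (comp_rewrite (ten_m_natural _ _ _ _)).
  by rewrite (comp_rewrite (theta_natural _ _)) -!comp_assoc.
- have pull_BD : (fmap (R T) (idm (pull f A)) ⊗m[t2] fmap (R T) (ten_m t1 f (B, D)))
      ∘ ((idm (R T (pull f A)) ⊗m[t2] rho T (pull f B, pull f D))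
      ∘ (theta R f A ⊗m[t2] (theta R f B ⊗m[t2] theta R f D))) =
    (theta R f A ⊗m[t2] theta R f (B ⊗[t1] D))
      ∘ ((fmap (pull f) (idm (R S A)) ⊗m[t2] fmap (pull f) (rho S (B, D)))
      ∘ (idm (pull f (R S A)) ⊗m[t2] ten_m t2 f (R S B, R S D))).
    by rewrite -!bmap_comp rho_pull_r !fmap_id !comp_id_l comp_id_r.
  rewrite E !fmap_comp -!comp_assoc.
  have ac2 := ac_pull a2 f (R S A) (R S B) (R S D).
  rewrite -!comp_assoc in ac2; rewrite ac2 assoc_natural.
  rewrite (comp_rewrite (eq_sym (rho_natural _ _))) -!comp_assoc.
  rewrite (comp_rewrite3 pull_BD) -!comp_assoc.
  rewrite (comp_rewrite3 (rho_pull_r _ _ _)) -!comp_assoc.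
  by rewrite (comp_rewrite (ten_m_natural _ _ _ _)) -!comp_assoc.
Qed.

(** Both sides are natural in the three objects, and split epimorphisms remain split under [R] and
    the tensor product. *)
Lemma associative_at_retract (a1 : AssocConstraint t1) (a2 : AssocConstraint t2)
    (S : C) (A A' B B' D D' : H1 S) (x : A ~> A') (y : B ~> B') (z : D ~> D') :
  split_epi x -> split_epi y -> split_epi z ->
  associative_at a1 a2 A B D -> associative_at a1 a2 A' B' D'.
Proof.
move=> hx hy hz.
apply: (@eq_on_retract _ _ _ _ _ _ _ _ _
  ((fmap (R S) x ⊗m[t2] fmap (R S) y) ⊗m[t2] fmap (R S) z)
  (fmap (R S) (x ⊗m[t1] (y ⊗m[t1] z)))).
- by do 2?[apply: split_epi_bmap]; apply: split_epi_fmap.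
- rewrite -!comp_assoc -bmap_comp rho_natural comp_id_l.
  (* The inserted identity separates the inner [rho] from the map on [D], so that naturality of the
     outer [rho] applies. *)
  rewrite -(comp_id_r (fmap (R S) z)) bmap_comp.
  rewrite (comp_rewrite (rho_natural _ _)) !comp_assoc.
  by rewrite -!fmap_comp assoc_natural.
- rewrite -!comp_assoc assoc_natural (comp_rewrite (eq_sym (bmap_comp _ _ _ _ _))).
  rewrite rho_natural comp_id_l -(comp_id_r (fmap (R S) x)) bmap_comp.
  by rewrite -!comp_assoc (comp_rewrite (rho_natural _ _)) -!comp_assoc.
Qed.

(** * Symmetry *)

(** The same comparison through the inverse image of the identity over [S], with [cc_pull] in place
    of [ac_pull]. *)
Lemma symmetric_at_pull (c1 : CommConstraint t1) (c2 : CommConstraint t2)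
    (T S : C) (f : T ~> S) (A B : H1 S) :
  symmetric_at c1 c2 A B -> symmetric_at c1 c2 (pull f A) (pull f B).
Proof.
rewrite /symmetric_at => E.
have iso_theta : is_iso (theta R f A ⊗m[t2] theta R f B).
  by apply: is_iso_bmap; apply: fwd_is_iso.
have iso_m : is_iso (fmap (R T) (ten_m t1 f (B, A))).
  by apply: is_iso_fmap; apply: fwd_is_iso.
apply: (iso_epi iso_theta); apply: (iso_mono iso_m).
transitivity (theta R f (B ⊗[t1] A)
  ∘ fmap (pull f) (fmap (R S) (c1 S (A, B)) ∘ rho S (A, B))
  ∘ ten_m t2 f (R S A, R S B)).
- rewrite !comp_assoc -fmap_comp cc_pull !fmap_comp -!comp_assoc rho_pull_r.
  by rewrite !comp_assoc theta_natural.
- rewrite E fmap_comp -!comp_assoc -cc_pull comm_natural.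
  by rewrite !comp_assoc rho_pull.
Qed.

Lemma symmetric_at_retract (c1 : CommConstraint t1) (c2 : CommConstraint t2)
    (S : C) (A A' B B' : H1 S) (x : A ~> A') (y : B ~> B') :
  split_epi x -> split_epi y ->
  symmetric_at c1 c2 A B -> symmetric_at c1 c2 A' B'.
Proof.
move=> hx hy.
apply: (@eq_on_retract _ _ _ _ _ _ _ _ _
  (fmap (R S) x ⊗m[t2] fmap (R S) y) (fmap (R S) (y ⊗m[t1] x))).
- by apply: split_epi_bmap; apply: split_epi_fmap.
- by rewrite -comp_assoc rho_natural !comp_assoc -!fmap_comp comm_natural.
- by rewrite -comp_assoc comm_natural !comp_assoc rho_natural.
Qed.

(** * Units *)

(** The common target [R T (pull f A)] contains no tensor product, so it suffices to cancel
    isomorphisms on the source. Compatibility of [w] with [f] relates [w S] to [w T]. *)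
Lemma unitary_r_at_pull (u1 : UnitConstraint t1) (u2 : UnitConstraint t2)
    (w : SectionIso (image_section R (uc_sec u1)) (uc_sec u2))
    (T S : C) (f : T ~> S) (A : H1 S) :
  unitary_r_at w A -> unitary_r_at w (pull f A).
Proof.
rewrite /unitary_r_at => E.
have iso_theta : is_iso (theta R f A ⊗m[t2] sec_pull (image_section R (uc_sec u1)) f).
  by apply: is_iso_bmap; apply: fwd_is_iso.
apply: (iso_epi iso_theta).
transitivity (theta R f A
  ∘ fmap (pull f) (fmap (R S) (uc_r u1 S A) ∘ rho S (A, uc_sec u1 S))
  ∘ ten_m t2 f (R S A, R S (uc_sec u1 S))).
(* The structure isomorphism of the image section is [theta] followed by [R] of that of the unit
   section; naturality of [rho] and [uc_r_pull] absorb the latter. *)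
- have -> : theta R f A ⊗m[t2] sec_pull (image_section R (uc_sec u1)) f =
      (fmap (R T) (idm (pull f A)) ⊗m[t2] fmap (R T) (sec_pull (uc_sec u1) f))
      ∘ (theta R f A ⊗m[t2] theta R f (uc_sec u1 S)).
    by rewrite -bmap_comp fmap_id comp_id_l.
  rewrite -!comp_assoc (comp_rewrite (rho_natural _ _)) !comp_assoc.
  rewrite -fmap_comp uc_r_pull !fmap_comp -!comp_assoc rho_pull_r.
  by rewrite !comp_assoc theta_natural.
- have w_pull : (idm (R T (pull f A)) ⊗m[t2] w T)
      ∘ (theta R f A ⊗m[t2] sec_pull (image_section R (uc_sec u1)) f) =
      (theta R f A ⊗m[t2] idm (uc_sec u2 T))
      ∘ ((idm (pull f (R S A)) ⊗m[t2] sec_pull (uc_sec u2) f)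
      ∘ (fmap (pull f) (idm (R S A)) ⊗m[t2] fmap (pull f) (w S))).
    by rewrite -!bmap_comp fmap_id !comp_id_l !comp_id_r sec_iso_pull.
  rewrite E fmap_comp -!comp_assoc w_pull (comp_rewrite (unit_r_natural _ _)).
  by rewrite -comp_assoc (comp_rewrite (uc_r_pull _ _ _)) -comp_assoc ten_m_natural.
Qed.

Lemma unitary_r_at_retract (u1 : UnitConstraint t1) (u2 : UnitConstraint t2)
    (w : SectionIso (image_section R (uc_sec u1)) (uc_sec u2))
    (S : C) (A A' : H1 S) (x : A ~> A') :
  split_epi x -> unitary_r_at w A -> unitary_r_at w A'.
Proof.
move=> hx.
apply: (@eq_on_retract _ _ _ _ _ _ _ _ _
  (fmap (R S) x ⊗m[t2] fmap (R S) (idm (uc_sec u1 S))) (fmap (R S) x)).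
- by apply: split_epi_bmap; apply: split_epi_fmap => //; exact: split_epi_id.
- by rewrite -comp_assoc rho_natural !comp_assoc -!fmap_comp unit_r_natural.
- rewrite fmap_id -comp_assoc -bmap_comp comp_id_l comp_id_r.
  (* By the interchange law [w S] can act first, leaving [x] to pass the unit constraint by
     naturality. *)
  have -> : fmap (R S) x ⊗m[t2] w S =
      (fmap (R S) x ⊗m[t2] idm (uc_sec u2 S)) ∘ (idm (R S A) ⊗m[t2] w S).
    by rewrite -bmap_comp comp_id_l comp_id_r.
  by rewrite comp_assoc unit_r_natural comp_assoc.
Qed.

(** The mirror image of [unitary_r_at_pull], with the unit section as first factor. *)
Lemma unitary_l_at_pull (u1 : UnitConstraint t1) (u2 : UnitConstraint t2)
    (w : SectionIso (image_section R (uc_sec u1)) (uc_sec u2))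
    (T S : C) (f : T ~> S) (A : H1 S) :
  unitary_l_at w A -> unitary_l_at w (pull f A).
Proof.
rewrite /unitary_l_at => E.
have iso_theta : is_iso (sec_pull (image_section R (uc_sec u1)) f ⊗m[t2] theta R f A).
  by apply: is_iso_bmap; apply: fwd_is_iso.
apply: (iso_epi iso_theta).
transitivity (theta R f A
  ∘ fmap (pull f) (fmap (R S) (uc_l u1 S A) ∘ rho S (uc_sec u1 S, A))
  ∘ ten_m t2 f (R S (uc_sec u1 S), R S A)).
- have -> : sec_pull (image_section R (uc_sec u1)) f ⊗m[t2] theta R f A =
      (fmap (R T) (sec_pull (uc_sec u1) f) ⊗m[t2] fmap (R T) (idm (pull f A)))
      ∘ (theta R f (uc_sec u1 S) ⊗m[t2] theta R f A).
    by rewrite -bmap_comp fmap_id comp_id_l.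
  rewrite -!comp_assoc (comp_rewrite (rho_natural _ _)) !comp_assoc.
  rewrite -fmap_comp uc_l_pull !fmap_comp -!comp_assoc rho_pull_r.
  by rewrite !comp_assoc theta_natural.
- have w_pull : (w T ⊗m[t2] idm (R T (pull f A)))
      ∘ (sec_pull (image_section R (uc_sec u1)) f ⊗m[t2] theta R f A) =
      (idm (uc_sec u2 T) ⊗m[t2] theta R f A)
      ∘ ((sec_pull (uc_sec u2) f ⊗m[t2] idm (pull f (R S A)))
      ∘ (fmap (pull f) (w S) ⊗m[t2] fmap (pull f) (idm (R S A)))).
    by rewrite -!bmap_comp fmap_id !comp_id_l !comp_id_r sec_iso_pull.
  rewrite E fmap_comp -!comp_assoc w_pull (comp_rewrite (unit_l_natural _ _)).
  by rewrite -comp_assoc (comp_rewrite (uc_l_pull _ _ _)) -comp_assoc ten_m_natural.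
Qed.

Lemma unitary_l_at_retract (u1 : UnitConstraint t1) (u2 : UnitConstraint t2)
    (w : SectionIso (image_section R (uc_sec u1)) (uc_sec u2))
    (S : C) (A A' : H1 S) (x : A ~> A') :
  split_epi x -> unitary_l_at w A -> unitary_l_at w A'.
Proof.
move=> hx.
apply: (@eq_on_retract _ _ _ _ _ _ _ _ _
  (fmap (R S) (idm (uc_sec u1 S)) ⊗m[t2] fmap (R S) x) (fmap (R S) x)).
- by apply: split_epi_bmap; apply: split_epi_fmap => //; exact: split_epi_id.
- by rewrite -comp_assoc rho_natural !comp_assoc -!fmap_comp unit_l_natural.
- rewrite fmap_id -comp_assoc -bmap_comp comp_id_l comp_id_r.
  have -> : w S ⊗m[t2] fmap (R S) x =
      (idm (uc_sec u2 S) ⊗m[t2] fmap (R S) x) ∘ (w S ⊗m[t2] idm (R S A)).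
    by rewrite -bmap_comp comp_id_l comp_id_r.
  by rewrite comp_assoc unit_l_natural comp_assoc.
Qed.

End TensorMorphism.

(** * Passage from [in_U B] to the whole base *)

Theorem lemma4p3 (B : Base) (H1 H2 : LocalicFibCat B)
  (t1 : LocalicTensor H1) (t2 : LocalicTensor H2) (R : LocalicFibMor H1 H2)
  (rho : TensorMor (restr_trimor (in_U B) R)
           (restr_tritensor (in_U B) t1) (restr_tritensor (in_U B) t2))
  (rho_tri : rho_triangulated rho)
  (rhot : TensorMor R t1 t2)
  (rhot_tri : rho_triangulated rhot)
  (rhot_restr : restr_rho (in_U B) rhot = rho) :
  (forall (a1 : AssocConstraint (restr_tensor (in_U B) t1))
      (a2 : AssocConstraint (restr_tensor (in_U B) t2))
      (at1 : AssocConstraint t1) (at2 : AssocConstraint t2),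
    restr_assoc (in_U B) at1 = a1 ->
    restr_assoc (in_U B) at2 = a2 ->
    rho_associative rho a1 a2 ->
    rho_associative rhot at1 at2) /\
  (forall (c1 : CommConstraint (restr_tensor (in_U B) t1))
      (c2 : CommConstraint (restr_tensor (in_U B) t2))
      (ct1 : CommConstraint t1) (ct2 : CommConstraint t2),
    restr_comm (in_U B) ct1 = c1 ->
    restr_comm (in_U B) ct2 = c2 ->
    rho_symmetric rho c1 c2 ->
    rho_symmetric rhot ct1 ct2) /\
  (forall (u1 : UnitConstraint (restr_tensor (in_U B) t1))
      (u2 : UnitConstraint (restr_tensor (in_U B) t2))
      (w : SectionIso (image_section (restr_mor (in_U B) R) (uc_sec u1)) (uc_sec u2))
      (ut1 : UnitConstraint t1) (ut2 : UnitConstraint t2)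
      (ut1_restr : restr_unit (in_U B) ut1 = u1)
      (ut2_restr : restr_unit (in_U B) ut2 = u2)
      (wt : SectionIso (image_section R (uc_sec ut1)) (uc_sec ut2)),
    section_iso_restricts ut1_restr ut2_restr wt w ->
    rho_unitary rho u1 u2 w ->
    rho_unitary rhot ut1 ut2 wt).
Proof.
subst rho; split; [|split].
- move=> a1 a2 at1 at2 <- <- assoc_rho S A B' D.
  (* A single [z] serves all three objects, so that [A0], [B0] and [D0] lie over the same [P]. *)
  have [P [z [hP hz]]] := closed_embedding_in_U S.
  have [A0 [x hx]] := retract_of_closed_pull hz A.
  have [B0 [y hy]] := retract_of_closed_pull hz B'.
  have [D0 [d hd]] := retract_of_closed_pull hz D.
  apply: (associative_at_retract hx hy hd); apply: associative_at_pull.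
  (* Restricted structures are evaluated at the underlying object, so the hypothesis at [P] is by
     conversion the condition on [rhot], [at1] and [at2]. *)
  exact: (assoc_rho (exist _ P hP) A0 B0 D0).
- move=> c1 c2 ct1 ct2 <- <- sym_rho S A B'.
  have [P [z [hP hz]]] := closed_embedding_in_U S.
  have [A0 [x hx]] := retract_of_closed_pull hz A.
  have [B0 [y hy]] := retract_of_closed_pull hz B'.
  apply: (symmetric_at_retract hx hy); apply: symmetric_at_pull.
  exact: (sym_rho (exist _ P hP) A0 B0).
- move=> u1 u2 w ut1 ut2 e1 e2 wt; subst u1 u2 => w_restr [unit_r unit_l].
  (* After the substitution both transports in [w_restr] are along reflexivity and compute to
     identities. *)
  have w_eq (X : full_sub (in_U B)) : fwd (w X) = wt (proj1_sig X).
    by have := w_restr X; rewrite /= comp_id_l comp_id_r.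
  split=> S A; have [P [z [hP hz]]] := closed_embedding_in_U S;
    have [A0 [x hx]] := retract_of_closed_pull hz A.
  + apply: (unitary_r_at_retract hx); apply: unitary_r_at_pull.
    by have := unit_r (exist _ P hP) A0; rewrite w_eq.
  + apply: (unitary_l_at_retract hx); apply: unitary_l_at_pull.
    by have := unit_l (exist _ P hP) A0; rewrite w_eq.
Qed.
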